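(* Let $N\ge1$ be an integer, $A>-1/2$, $B\in(-A,A+1)$, $C<-A-N+1$, and $\mathcal T=(-A-B,\infty)$. Let $\Theta$ be a random variable with law $$\Pr(\Theta=k)=\frac{(A-B+1)_N\,(A+C)_k\,(-N)_k}{(1-B-C)_N\,k!\,(A-B+1)_k},\qquad k=0,1,\dots,N,$$ and suppose that conditionally on $\Theta=K$ the process $(\xi_t^{(\Theta)})$ is the Markov chain $(\xi_t^{(K)})$ described in the context. Then the unconditional joint laws of $(\xi^{(\Theta)}_t)_{t\in\mathcal T}$ are those of the Markov chain $(\xi_t)_{t\in\mathcal T}$ with parameters $N,A,B,C$ described in the context: for all $t_1<\dots<t_n$ in $\mathcal T$ and all integers $0\le j_1\le\dots\le j_n\le N$, $$\sum_{k=j_n}^N\Pr(\Theta=k)\Pr\left(\xi_{t_1}^{(k)}=j_1,\dots,\xi_{t_n}^{(k)}=j_n\right)=\Pr(\xi_{t_1}=j_1,\dots,\xi_{t_n}=j_n).$$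
   Context: Pochhammer symbol: $(\alpha)_0=1$, $(\alpha)_k=\alpha(\alpha+1)\cdots(\alpha+k-1)$. For integers $0\le j\le K$, $\pi_{j,K}(a,b)=\binom Kj\dfrac{(a-b+j+1)_{K-j}}{(a+2j+1)_{K-j}}\cdot\dfrac{(b)_j}{(a+j)_j}$. For $K\in\{0,1,\dots\}$, $(\xi^{(K)}_t)_{t\ge -A-B}$ is the Markov chain on $\{0,\dots,K\}$ with $\xi^{(K)}_{-A-B}=0$ and, for $s<t$, $\Pr(\xi_t^{(K)}=j\mid\xi_s^{(K)}=m)=\pi_{j-m,K-m}(2A+2m+t,\,t-s)$ for $m\le j\le K$, and $0$ for $j<m$. For integers $0\le k\le N$, $$p_{k,N}(a,b,c)=C_N(a,b,c)\,\frac{(2a)_k(a+1)_k(a+b)_k(a+c)_k(-N)_k}{k!\,(a)_k(a-b+1)_k(a-c+1)_k(2a+N+1)_k},\qquad C_N(a,b,c)=\frac{(a-b+1)_N(a-c+1)_N}{(2a+1)_N(-b-c+1)_N},$$ where $(2a)_k(a+1)_k/(a)_k$ is read as $1$ if $k=0$ and $2(2a+1)_{k-1}(a+k)$ if $k\ge1$ (so $a=0$ is allowed). $(\xi_t)_{t\in\mathcal T}$ is the Markov chain on $\{0,\dots,N\}$ with $\Pr(\xi_t=j)=p_{j,N}(A+\tfrac t2,B+\tfrac t2,C-\tfrac t2)$ and, for $s<t$ in $\mathcal T$, $\Pr(\xi_t=n\mid\xi_s=k)=p_{n-k,N-k}(A+\tfrac t2+k,-A-s+\tfrac t2-k,C-\tfrac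 t2)$ for $0\le k\le n\le N$, and $0$ for $n<k$. *)

(* Defs.v *)
From HB Require Import structures.
From mathcomp Require Import all_boot all_order all_algebra.
From mathcomp Require Import all_classical all_reals all_analysis.

Set Implicit Arguments.
Unset Strict Implicit.
Unset Printing Implicit Defensive.

Import Order.TTheory GRing.Theory Num.Theory.

Local Open Scope classical_set_scope.
Local Open Scope ring_scope.

Definition pochhammer (R : realType) (a : R) (k : nat) : R :=
  \prod_(i < k) (a + i%:R).

Definition pi_weight (R : realType) (j K : nat) (a b : R) : R :=
  'C(K, j)%:R
  * (pochhammer (a - b + j%:R + 1) (K - j)
     / pochhammer (a + 2 * j%:R + 1) (K - j))
  * (pochhammer b j / pochhammer (a + j%:R) j).

Definition C_weight (R : realType) (N : nat) (a b c : R) : R :=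
  pochhammer (a - b + 1) N * pochhammer (a - c + 1) N
  / (pochhammer (2 * a + 1) N * pochhammer (- b - c + 1) N).

(* (2a)_k (a+1)_k / (a)_k, extended by continuity to a = 0. *)
Definition well_poised_factor (R : realType) (a : R) (k : nat) : R :=
  if k is k'.+1 then 2 * pochhammer (2 * a + 1) k' * (a + k%:R) else 1.

Definition p_weight (R : realType) (k N : nat) (a b c : R) : R :=
  C_weight N a b c
  * (well_poised_factor a k
     * pochhammer (a + b) k * pochhammer (a + c) k * pochhammer (- N%:R) k
     / (k`!%:R * pochhammer (a - b + 1) k * pochhammer (a - c + 1) k
        * pochhammer (2 * a + N%:R + 1) k)).

Definition theta_law (R : realType) (N : nat) (A B C : R) (k : nat) : R :=
  if (k <= N)%N then
    pochhammer (A - B + 1) N * pochhammer (A + C) k * pochhammer (- N%:R) k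
    / (pochhammer (1 - B - C) N * k`!%:R * pochhammer (A - B + 1) k)
  else 0.

Definition prob d (T : measurableType d) (R : realType)
  (P : probability T R) (E : set T) : R := fine (P E).

(* Real-valued set functions rather than measures, so that a conditional
   probability can itself be conditioned; only used when Q F != 0. *)
Definition cond (T : Type) (R : realType) (Q : set T -> R) (F E : set T) : R :=
  Q (E `&` F) / Q F.

(* {X_(t_0) = j_0, ..., X_(t_(n-1)) = j_(n-1)} *)
Definition path_event d (T : measurableType d) (R : realType)
    (X : R -> {mfun T >-> nat}) (t : nat -> R) (j : nat -> nat) (n : nat)
  : set T := \bigcap_(i < n) (X (t i) @^-1` [set j i]).

(* Under Q, the family (X_t)_(t in I) is a Markov chain on {0, ..., K} with
   transition probabilities tr s t m j = Q(X_t = j | X_s = m). *)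
Record markov_chain d (T : measurableType d) (R : realType)
    (Q : set T -> R) (X : R -> {mfun T >-> nat}) (I : set R) (K : nat)
    (tr : R -> R -> nat -> nat -> R) : Prop := MarkovChain {
  chain_range : forall t, I t -> Q [set w | (X t w <= K)%N] = 1 ;
  chain_markov : forall (n : nat) (t : nat -> R) (j : nat -> nat),
    (forall i, (i <= n.+1)%N -> I (t i)) ->
    (forall i, (i <= n)%N -> t i < t i.+1) ->
    0 < Q (path_event X t j n.+1) ->
    cond Q (path_event X t j n.+1) (X (t n.+1) @^-1` [set j n.+1])
    = cond Q (X (t n) @^-1` [set j n]) (X (t n.+1) @^-1` [set j n.+1]) ;
  chain_trans : forall (s t : R) (m j : nat),
    I s -> I t -> s < t -> (m <= K)%N -> (j <= K)%N ->
    0 < Q (X s @^-1` [set m]) ->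
    cond Q (X s @^-1` [set m]) (X t @^-1` [set j]) = tr s t m j }.

Definition xiK_trans (R : realType) (K : nat) (A : R) (s t : R) (m j : nat)
  : R :=
  if (m <= j <= K)%N then
    pi_weight (j - m) (K - m) (2 * A + 2 * m%:R + t) (t - s)
  else 0.

Definition xi_trans (R : realType) (N : nat) (A C : R) (s t : R) (k n : nat)
  : R :=
  if (k <= n <= N)%N then
    p_weight (n - k) (N - k) (A + t / 2 + k%:R) (- A - s + t / 2 - k%:R)
      (C - t / 2)
  else 0.

(* The chain xi^(K) on [-A-B, +oo[ started at 0. *)
Record is_xiK (R : realType) (K : nat) (A B : R) d (T : measurableType d)
    (Q : set T -> R) (X : R -> {mfun T >-> nat}) : Prop := IsXiK {
  xiK_chain :
    markov_chain Q X [set t | - A - B <= t] K (xiK_trans K A) ;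
  xiK_start : Q (X (- A - B) @^-1` [set 0%N]) = 1 }.

(* The chain xi on ]-A-B, +oo[ with parameters N, A, B, C. *)
Record is_xi (R : realType) (N : nat) (A B C : R) d (T : measurableType d)
    (Q : set T -> R) (X : R -> {mfun T >-> nat}) : Prop := IsXi {
  xi_chain :
    markov_chain Q X [set t | - A - B < t] N (xi_trans N A C) ;
  xi_law : forall (t : R) (j : nat), - A - B < t -> (j <= N)%N ->
    Q (X t @^-1` [set j])
    = p_weight j N (A + t / 2) (B + t / 2) (C - t / 2) }.

(* Main.v *)
Require Import Defs.
From HB Require Import structures.
From mathcomp Require Import all_boot all_order all_algebra.
From mathcomp Require Import all_classical all_reals all_analysis.
From mathcomp Require Import ring lra zify.

Set Implicit Arguments.
Unset Strict Implicit.
Unset Printing Implicit Defensive.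

Import Order.TTheory GRing.Theory Num.Theory.

Local Open Scope classical_set_scope.
Local Open Scope ring_scope.

(** Why the mixture is a Markov chain.  Once the path of the mixed process has
    been observed up to time s, the conditional law of Theta depends on the
    path only through the current state m, and it again belongs to the family
    of laws of Theta: it is the law of m + Theta', where Theta' has the
    parameters N - m, A + m, -A - s - m, C in place of N, A, B, C
    ([posterior]).  Inductively, everything reduces to a single application of
    Bayes' rule,
      P(Theta = K | m at time s) * P(m -> j for xi^(K))
        = P(m -> j for xi) * P(Theta = K | j at time t),
    which is an identity between products of Pochhammer symbols
    ([theta_law_pi_weight], [posterior_step]): the factors depending on K
    recombine into a law of the same shape, and what remains is the
    well-poised weight p.  The start fits into the same scheme, because being
    in the state 0 at time -A-B carries no information on Theta
    ([posterior_start]), and the one-dimensional laws of xi are what its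
    transition probabilities out of that space-time point give formally.

    Iterating along a path and summing over K, where the posterior laws have
    total mass 1 by the Chu-Vandermonde identity ([sum_posterior]), shows that
    the mixture gives each path the product of the transition probabilities
    of xi ([sum_path]).

    On the probabilistic side, a Markov chain gives each path the product of
    its transition probabilities ([markov_path]) and conversely
    ([path_markov]).  As the definition of a chain is applied both to
    probability measures and to the real-valued conditional probabilities
    given Theta = K, these facts are proved for finitely additive
    probabilities, which is enough to treat finitely many times and finitely
    many values of Theta. *)

(** * Pochhammer symbols and the Chu-Vandermonde identity *)

Section Pochhammer.
Variable R : realType.
Implicit Types (x u v : R) (k m n N : nat).

Lemma pochhammer0 x : pochhammer x 0 = 1.
Proof. by rewrite /pochhammer big_ord0. Qed.

Lemma pochhammerSr x n : pochhammer x n.+1 = pochhammer x n * (x + n%:R).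
Proof. by rewrite /pochhammer big_ord_recr. Qed.

Lemma pochhammerD x m n :
  pochhammer x (m + n) = pochhammer x m * pochhammer (x + m%:R) n.
Proof.
elim: n => [|n IHn]; first by rewrite addn0 pochhammer0 mulr1.
by rewrite addnS !pochhammerSr IHn -mulrA natrD addrA.
Qed.

Lemma pochhammerSl x n : pochhammer x n.+1 = x * pochhammer (x + 1) n.
Proof.
by rewrite -add1n pochhammerD pochhammerSr pochhammer0 mul1r addr0.
Qed.

Lemma pochhammer_gt0 x n : 0 < x -> 0 < pochhammer x n.
Proof.
by move=> x0; apply: prodr_gt0 => i _; apply: ltr_wpDr; rewrite ?ler0n.
Qed.

Lemma pochhammer_neq0 x n : 0 < x -> pochhammer x n != 0.
Proof. by move=> x0; rewrite gt_eqF ?pochhammer_gt0. Qed.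

Lemma pochhammer_oppn N k :
  pochhammer (- N%:R : R) k = (-1) ^+ k * ('C(N, k) * k`!)%:R.
Proof.
rewrite bin_ffact; elim: k => [|k IHk].
  by rewrite pochhammer0 ffactn0 expr0 mulr1.
rewrite pochhammerSr IHk ffactnSr exprS natrM.
have [kN|Nk] := leqP k N; first by rewrite natrB//; ring.
by rewrite (ffact_small Nk) !(mul0r, mulr0).
Qed.

(** The terminating 2F1(-N, v; u; 1) multiplied by (u)_N, so that the identity
    is polynomial in u and v.  By Pascal's rule the sum for N + 1 is the sum
    for N and u + 1, each term being multiplied by
    (u + k) - (v + k) = u - v. *)
Lemma chu_vandermonde u v N :
  \sum_(0 <= k < N.+1)
    'C(N, k)%:R * (-1) ^+ k * pochhammer v k * pochhammer (u + k%:R) (N - k)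
  = pochhammer (u - v) N.
Proof.
elim: N u => [|N IHN] u.
  by rewrite big_nat1 !pochhammer0 bin0 expr0 !mulr1.
rewrite pochhammerSl addrAC -IHN.
rewrite big_nat_recl// bin0 expr0 pochhammer0 addr0 subn0 !mul1r.
under eq_bigr => k _ do rewrite binS natrD !mulrDl.
(* Of the two halves produced by Pascal's rule, the one with 'C(N, k.+1)
   absorbs the initial term and is shifted back to the index k. *)
rewrite big_split /= addrA.
have -> : pochhammer u N.+1 + \sum_(0 <= i < N.+1) 'C(N, i.+1)%:R *
      (-1) ^+ i.+1 * pochhammer v i.+1 * pochhammer (u + i.+1%:R) (N.+1 - i.+1)
    = \sum_(0 <= i < N.+1) 'C(N, i)%:R *
      (-1) ^+ i * pochhammer v i * pochhammer (u + i%:R) (N.+1 - i).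
  rewrite [in LHS]big_nat_recr//= bin_small// !mul0r addr0.
  by rewrite [in RHS]big_nat_recl// bin0 expr0 pochhammer0 addr0 subn0 !mul1r.
rewrite -big_split mulr_sumr /=; apply: eq_big_nat => k /andP[_ kN].
rewrite subSS subSn// (pochhammerSr v) exprS pochhammerSl -addrA natr1.
by rewrite (addrAC u 1) -addrA natr1; ring.
Qed.

End Pochhammer.

(** * Bayes' rule for the weights *)

Section Weights.
Variable R : realType.
Implicit Types (a b c t : R) (j K M : nat).

Lemma theta_denominator_neq0 M a b c : b < a + 1 ->
  c < - a - M%:R + 1 -> pochhammer (1 - b - c) M != 0.
Proof.
case: M => [|M] hb hc; first by rewrite pochhammer0 oner_neq0.
by apply: pochhammer_neq0; move: hc (ler0n R M); rewrite -natr1; lra.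
Qed.

Lemma sum_theta_law M a b c : b < a + 1 -> c < - a - M%:R + 1 ->
  \sum_(0 <= k < M.+1) theta_law M a b c k = 1.
Proof.
move=> hb hc; have u0 : 0 < a - b + 1 by lra.
have w0 := theta_denominator_neq0 hb hc.
have := chu_vandermonde (a - b + 1) (a + c) M.
rewrite (_ : a - b + 1 - (a + c) = 1 - b - c); last by ring.
move=> /(congr1 (fun x => x / pochhammer (1 - b - c) M)).
rewrite divff// => <-; rewrite mulr_suml; apply: eq_big_nat => k /andP[_ kM].
rewrite /theta_law -ltnS kM pochhammer_oppn natrM.
have -> : pochhammer (a - b + 1) M =
   pochhammer (a - b + 1) k * pochhammer (a - b + 1 + k%:R) (M - k).
  by rewrite -pochhammerD subnKC.
have k0 : (k`!%:R : R) != 0 by rewrite pnatr_eq0 -lt0n fact_gt0.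
have p0 := pochhammer_neq0 k u0.
by field; rewrite k0 p0 w0.
Qed.

(** This is what allows a / 2 to vanish: the factor that stands for
    (a)_k (a/2 + 1)_k / (a/2)_k is used only through this product. *)
Lemma well_poised_factorE a j :
  well_poised_factor (a / 2) j * pochhammer (a + j%:R) j
   = pochhammer (a + 1) (j + j).
Proof.
case: j => [|j] /=; first by rewrite !pochhammer0 mulr1.
have -> : 2 * (a / 2) = a by field.
rewrite addSn -addnS pochhammerD.
have -> : a + 1 + j%:R = a + j.+1%:R by rewrite -addrA nat1r.
by rewrite (pochhammerSr _ j.+1) -!natr1; field.
Qed.

(** Bayes' rule at the starting point.  With v = a + c and e = 2 a + t,
    the symbols with base a - b + 1, v, - M and e - v + 1 match on both sides
    once they are split at index j; the other ones balance by
    (e + 1)_M (e + 1 + M)_j = (e + 1)_(2 j) (e + 1 + 2 j)_(M - j)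
    combined with [well_poised_factorE].  The inequalities on the real
    parameters keep the denominators from vanishing. *)
Lemma theta_law_pi_weight M a b c t j K : (j <= K <= M)%N ->
  0 < a - b + 1 -> 0 < 2 * a + t + 1 -> c < - a - M%:R + 1 ->
  theta_law M a b c K * pi_weight j K (2 * a + t) (a + b + t)
  = p_weight j M (a + t / 2) (b + t / 2) (c - t / 2)
    * theta_law (M - j) (a + j%:R) (- a - t - j%:R) c (K - j).
Proof.
move=> /andP[jK KM] u0 e0 hc; have jM := leq_trans jK KM.
rewrite /theta_law KM leq_sub2r// /pi_weight /p_weight /C_weight.
set e := 2 * a + t; set v := a + c.
have -> : e - (a + b + t) + j%:R + 1 = a - b + 1 + j%:R by rewrite /e; ring.
have -> : e + 2 * j%:R + 1 = e + 1 + (j + j)%:R by rewrite natrD; ring.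
have -> : a + t / 2 - (b + t / 2) + 1 = a - b + 1 by ring.
have -> : a + t / 2 - (c - t / 2) + 1 = e - v + 1 by rewrite /e /v; field.
have -> : 2 * (a + t / 2) + 1 = e + 1 by rewrite /e; field.
have -> : - (b + t / 2) - (c - t / 2) + 1 = 1 - b - c by ring.
have -> : a + t / 2 + (b + t / 2) = a + b + t by field.
have -> : a + t / 2 + (c - t / 2) = v by rewrite /v; ring.
have -> : 2 * (a + t / 2) + M%:R + 1 = e + 1 + M%:R by rewrite /e; field.
have -> : a + j%:R - (- a - t - j%:R) + 1 = e + 1 + (j + j)%:R.
  by rewrite /e natrD; ring.
have -> : a + j%:R + c = v + j%:R by rewrite /v; ring.
have -> : 1 - (- a - t - j%:R) - c = e - v + 1 + j%:R by rewrite /e /v; ring.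
have -> : - (M - j)%:R = - M%:R + j%:R :> R by rewrite natrB//; ring.
have -> : a + t / 2 = e / 2 by rewrite /e; field.
have := well_poised_factorE e j.
have splitj x : pochhammer x M = pochhammer x j * pochhammer (x + j%:R) (M - j) :> R.
  by rewrite -pochhammerD subnKC.
have splitK x : pochhammer x K = pochhammer x j * pochhammer (x + j%:R) (K - j) :> R.
  by rewrite -pochhammerD subnKC.
have e1 : pochhammer (e + 1) M * pochhammer (e + 1 + M%:R) j =
    pochhammer (e + 1) (j + j) * pochhammer (e + 1 + (j + j)%:R) (M - j).
  by rewrite -!pochhammerD -addnA subnKC// addnC.
have ev0 x : pochhammer (e - v + 1 + x%:R) (M - x) != 0.
  have [Mx|xM] := leqP M x; first by rewrite (eqP Mx) pochhammer0 oner_neq0.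
  apply: pochhammer_neq0; have := ler0n R x.
  have : 1 <= M%:R :> R by rewrite ler1n (leq_trans _ xM).
  by rewrite /e /v; lra.
have := ev0 0%N; rewrite addr0 subn0 splitj mulf_eq0 negb_or => /andP[ev1 _].
have {}ev0 := ev0 j.
rewrite (splitj (a - b + 1)).
rewrite (splitK v) (splitK (- M%:R)) (splitK (a - b + 1)).
rewrite -(bin_fact jK) !natrM.
have E0 : 0 < e + 1 by [].
have e1E : pochhammer (e + 1) M = pochhammer (e + 1) (j + j) *
    pochhammer (e + 1 + (j + j)%:R) (M - j) / pochhammer (e + 1 + M%:R) j.
  by rewrite -e1 mulfK// pochhammer_neq0// ltr_wpDr.
rewrite e1E => wE.
have Z0 : pochhammer (e + 1) (j + j) != 0 by rewrite pochhammer_neq0.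
have /andP[w0 q0] : (well_poised_factor (e / 2) j != 0)
    && (pochhammer (e + j%:R) j != 0).
  by rewrite -negb_or -mulf_eq0 wE.
rewrite -wE.
field.
rewrite ?w0 ?q0 ?ev0 ?ev1 (theta_denominator_neq0 _ hc)//; last by lra.
rewrite !pnatr_eq0 -!lt0n !fact_gt0 bin_gt0 jK /=.
by rewrite !pochhammer_neq0// ltr_wpDr.
Qed.

End Weights.

Section Posterior.
Variables (R : realType) (N : nat) (A B C : R).
Implicit Types (s t : R) (j m K : nat).

(** The conditional law of Theta given that the mixed process is in the state j
    at time t. *)
Definition posterior t j K : R :=
  if (j <= K)%N then
    theta_law (N - j) (A + j%:R) (- A - t - j%:R) C (K - j) else 0.

Lemma posterior_start K : posterior (- A - B) 0 K = theta_law N A B C K.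
Proof.
by rewrite /posterior leq0n !subn0 addr0 subr0; congr theta_law; ring.
Qed.

Hypotheses (hB : - A < B < A + 1) (hC : C < - A - N%:R + 1).

Lemma sum_posterior t j : - A - B <= t -> (j <= N)%N ->
  \sum_(j <= K < N.+1) posterior t j K = 1.
Proof.
move=> ht jN; rewrite -{1}[j]add0n big_addn subSn//.
have j0 : (0 : R) <= j%:R by rewrite ler0n.
rewrite -[RHS](@sum_theta_law _ (N - j) (A + j%:R) (- A - t - j%:R) C).
- by apply: eq_bigr => i _; rewrite /posterior leq_addl addnK.
- by case/andP: hB; lra.
- by rewrite natrB//; move: hC; lra.
Qed.

(** Restarting xi^(K) from the state m at time s yields m + xi^(K - m) with A
    replaced by A + m and B by - A - s - m, the value for which the new
    starting time is s. *)
Lemma posterior_step s t m j K : - A - B <= s -> s < t -> (K <= N)%N ->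
  posterior s m K * xiK_trans K A s t m j
  = xi_trans N A C s t m j * posterior t j K.
Proof.
move=> hs st KN; rewrite /xiK_trans /xi_trans.
have [mj /=|jm /=] := leqP m j; last by rewrite mulr0 mul0r.
have [jK|Kj] := leqP j K; last by rewrite /posterior (leqNgt j K) Kj !mulr0.
have [mK jN] := (leq_trans mj jK, leq_trans jK KN).
have mN := leq_trans mj jN.
rewrite jN /posterior jK mK.
have m0 : (0 : R) <= m%:R by rewrite ler0n.
have -> : 2 * A + 2 * m%:R + t = 2 * (A + m%:R) + t by ring.
have -> : t - s = A + m%:R + (- A - s - m%:R) + t by ring.
rewrite theta_law_pi_weight ?leq_sub2r//.
- rewrite (_ : A + m%:R + t / 2 = A + t / 2 + m%:R); last by ring.
  rewrite (_ : - A - s - m%:R + t / 2 = - A - s + t / 2 - m%:R); last by ring.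
  congr (_ * theta_law _ _ _ _ _); rewrite ?natrB//; do ?[lia | ring].
- by case/andP: hB; lra.
- by case/andP: hB; lra.
- by rewrite natrB//; move: hC; lra.
Qed.

End Posterior.

(** * Weights of paths *)

(** The starting point (s, m) is kept apart from the observed path: for xi it is
    only formal, the time - A - B being outside its time set. *)
Definition chain_weight (R : realType) (tr : R -> R -> nat -> nat -> R)
    (s : R) (m : nat) (t : nat -> R) (j : nat -> nat) (n : nat) : R :=
  tr s (t 0%N) m (j 0%N) * \prod_(i < n) tr (t i) (t i.+1) (j i) (j i.+1).

Lemma chain_weightS (R : realType) (tr : R -> R -> nat -> nat -> R) s m t j n :
  chain_weight tr s m t j n.+1
  = chain_weight tr s m t j n * tr (t n) (t n.+1) (j n) (j n.+1).
Proof. by rewrite /chain_weight big_ord_recr mulrA. Qed.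

Lemma chain_weight_eq0 (R : realType) (tr : R -> R -> nat -> nat -> R) s m t j n :
  (forall s t m, tr s t m (j n) = 0) -> chain_weight tr s m t j n = 0.
Proof.
case: n => [|n] tr0; first by rewrite /chain_weight tr0 mul0r.
by rewrite chain_weightS tr0 mulr0.
Qed.

Lemma xiK_trans_eq0 (R : realType) K (A s t : R) m j :
  ~~ (m <= j <= K)%N -> xiK_trans K A s t m j = 0.
Proof. by rewrite /xiK_trans => /negbTE ->. Qed.

Lemma xi_trans_eq0 (R : realType) N (A C s t : R) m j :
  ~~ (m <= j <= N)%N -> xi_trans N A C s t m j = 0.
Proof. by rewrite /xi_trans => /negbTE ->. Qed.

Section PathWeights.
Variables (R : realType) (N : nat) (A B C : R).
Hypotheses (hB : - A < B < A + 1) (hC : C < - A - N%:R + 1).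
Variables (n : nat) (t : nat -> R) (j : nat -> nat).
Hypotheses (ht : forall i, (i <= n)%N -> - A - B < t i)
  (tS : forall i, (i < n)%N -> t i < t i.+1).

Local Notation weight := (chain_weight (xi_trans N A C) (- A - B) 0 t j).
Local Notation weightK K := (chain_weight (xiK_trans K A) (- A - B) 0 t j).

(** The joint law of Theta and the first k + 1 observed states. *)
Lemma posterior_path k K : (k <= n)%N -> (K <= N)%N ->
  theta_law N A B C K * weightK K k = weight k * posterior N A C (t k) (j k) K.
Proof.
move=> + KN; elim: k => [|k IHk] kn.
  rewrite /chain_weight !big_ord0 !mulr1 -posterior_start.
  by apply: (posterior_step hB hC) => //; exact: ht.
rewrite !chain_weightS mulrA IHk; last exact: ltnW.
rewrite -mulrA (posterior_step hB hC) ?mulrA//.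
- by apply/ltW/ht; exact: ltnW.
- exact: tS.
Qed.

Lemma sum_path_ge : (j n <= N)%N ->
  \sum_(j n <= K < N.+1) theta_law N A B C K * weightK K n = weight n.
Proof.
move=> jN; rewrite -[RHS]mulr1.
rewrite -(sum_posterior hB hC (ltW (ht (leqnn n))) jN).
rewrite mulr_sumr; apply: eq_big_nat => K /andP[_ KN].
exact: posterior_path.
Qed.

Lemma sum_path :
  \sum_(0 <= K < N.+1) theta_law N A B C K * weightK K n = weight n.
Proof.
have [jN|Nj] := leqP (j n) N.
  rewrite (big_cat_nat (n := j n))//=; last exact: leqW.
  rewrite sum_path_ge// big_nat big1 ?add0r// => K /andP[_ Kj].
  rewrite posterior_path//; last exact: leq_trans (ltnW Kj) jN.
  by rewrite /posterior leqNgt Kj mulr0.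
have -> : weight n = 0.
  apply: chain_weight_eq0 => s' t' m'.
  by rewrite xi_trans_eq0// negb_and -!ltnNge Nj orbT.
rewrite big_nat big1// => K /andP[_ KN].
by rewrite posterior_path// /posterior leqNgt (leq_trans KN)// mulr0.
Qed.

End PathWeights.

(** * Finitely additive probabilities *)

(** The common structure of [prob P] and of [cond (prob P) F], the latter being
    a bare real-valued set function. *)
Record finitely_additive_probability d (T : measurableType d) (R : realType)
    (Q : set T -> R) : Prop := FinitelyAdditiveProbability {
  fap_ge0 : forall E, measurable E -> 0 <= Q E ;
  fap_setT : Q setT = 1 ;
  fap_setU : forall E F, measurable E -> measurable F -> E `&` F = set0 ->
    Q (E `|` F) = Q E + Q F }.

Lemma fap_prob d (T : measurableType d) (R : realType) (P : probability T R) :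
  finitely_additive_probability (prob P).
Proof.
split=> [E mE||E F mE mF EF]; rewrite /prob.
- exact/fine_ge0/measure_ge0.
- by rewrite probability_setT.
- by rewrite measureU// fineD// fin_num_measure.
Qed.

Section FinitelyAdditive.
Context d (T : measurableType d) (R : realType) (Q : set T -> R).
Hypothesis hQ : finitely_additive_probability Q.
Implicit Types E F : set T.

Lemma fap_le E F : measurable E -> measurable F -> E `<=` F -> Q E <= Q F.
Proof.
move=> mE mF EF; rewrite -(setDUK EF) (fap_setU hQ)//; last 2 first.
- exact: measurableD.
- exact: setDIK.
by rewrite lerDl (fap_ge0 hQ)//; exact: measurableD.
Qed.

Lemma fap_null E F : measurable E -> measurable F -> E `<=` F ->
  Q F = 0 -> Q E = 0.
Proof.
move=> mE mF EF QF; apply/eqP; rewrite eq_le (fap_ge0 hQ)// andbT.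
by rewrite -QF; exact: fap_le.
Qed.

Lemma fap_setC F : measurable F -> Q (~` F) = 1 - Q F.
Proof.
move=> mF; rewrite -(fap_setT hQ) -(setUv F) (fap_setU hQ) ?setICr//.
  by rewrite addrC addKr.
exact: measurableC.
Qed.

Lemma fap_setIr E F : measurable E -> measurable F -> Q F = 1 ->
  Q (E `&` F) = Q E.
Proof.
move=> mE mF QF; rewrite -[in RHS](setUIDK E F) (fap_setU hQ).
- rewrite (_ : Q (E `\` F) = 0) ?addr0//.
  apply: (@fap_null _ (~` F)); [exact: measurableD|exact: measurableC| |].
    by move=> x [].
  by rewrite fap_setC// QF subrr.
- exact: measurableI.
- exact: measurableD.
- by rewrite setIDA; apply/seteqP; split => x //= [[[]]].
Qed.

Lemma fap_cond F : measurable F -> Q F != 0 ->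
  finitely_additive_probability (cond Q F).
Proof.
move=> mF QF; split=> [E mE||E E' mE mE' EE']; rewrite /cond.
- by rewrite divr_ge0// (fap_ge0 hQ)//; exact: measurableI.
- by rewrite setTI divff.
- rewrite setIUl (fap_setU hQ) ?mulrDl//; do ?exact: measurableI.
  by rewrite setIACA EE' set0I.
Qed.

End FinitelyAdditive.

(** * Path laws of Markov chains *)

Section Paths.
Context d (T : measurableType d) (R : realType) (X : R -> {mfun T >-> nat}).
Implicit Types (t : nat -> R) (j : nat -> nat) (n : nat).

Lemma measurable_preimage_nat (f : {mfun T >-> nat}) (D : set nat) :
  measurable (f @^-1` D).
Proof. exact: measurable_funPTI. Qed.

Lemma path_eventS t j n :
  path_event X t j n.+1 = X (t n) @^-1` [set j n] `&` path_event X t j n.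
Proof.
apply/seteqP; split => [x h|x [h0 h] i /=].
  by split=> [|i /= ?]; apply: h => //=; exact: ltnW.
by rewrite ltnS leq_eqVlt => /predU1P[->//|]; exact: h.
Qed.

Lemma path_event0 t j : path_event X t j 0 = setT.
Proof. by apply/seteqP; split. Qed.

Lemma path_event1 t j : path_event X t j 1 = X (t 0%N) @^-1` [set j 0%N].
Proof. by rewrite path_eventS path_event0 setIT. Qed.

Lemma path_event_cons t j n :
  path_event X t j n.+1 = X (t 0%N) @^-1` [set j 0%N] `&`
    path_event X (fun i => t i.+1) (fun i => j i.+1) n.
Proof.
elim: n => [|n IHn]; first by rewrite path_event1 path_event0 setIT.
by rewrite path_eventS IHn setICA -path_eventS.
Qed.

Lemma measurable_path_event t j n : measurable (path_event X t j n).
Proof.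
elim: n => [|n IHn]; first by rewrite path_event0.
by rewrite path_eventS; apply: measurableI => //; exact: measurable_preimage_nat.
Qed.

Lemma path_event_sub t j n :
  path_event X t j n.+1 `<=` X (t n) @^-1` [set j n].
Proof. by rewrite path_eventS => x []. Qed.

Variable Q : set T -> R.
Hypothesis hQ : finitely_additive_probability Q.
Variables (I : set R) (K : nat) (tr : R -> R -> nat -> nat -> R).

Lemma chain_out (s : R) (m : nat) :
  Q [set w | (X s w <= K)%N] = 1 -> (K < m)%N -> Q (X s @^-1` [set m]) = 0.
Proof.
move=> QK Km; pose F := [set w | (X s w <= K)%N].
have mF : measurable F by exact: (measurable_preimage_nat _ [set k | (k <= K)%N]).
apply: (fap_null hQ _ (measurableC mF)); first exact: measurable_preimage_nat.
  by move=> x /= Xx; apply/negP; rewrite Xx -ltnNge.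
by rewrite (fap_setC hQ mF) QK subrr.
Qed.

(** The Markov property determines conditional probabilities given events of
    positive probability only; a null path has null extensions, so that the
    product formula holds for it as well. *)
Lemma markov_path : markov_chain Q X I K tr ->
  (forall (s s' : R) (m k : nat), ~~ (m <= k <= K)%N -> tr s s' m k = 0) ->
  forall n t j, (forall i, (i <= n)%N -> I (t i)) ->
  (forall i, (i < n)%N -> t i < t i.+1) ->
  Q (path_event X t j n.+1) = Q (X (t 0%N) @^-1` [set j 0%N])
    * \prod_(i < n) tr (t i) (t i.+1) (j i) (j i.+1).
Proof.
move=> [hK hM htr] tr0 n t j; elim: n => [|n IHn] It tS.
  by rewrite path_event1 big_ord0 mulr1.
rewrite big_ord_recr /= mulrA -IHn; last 2 first.
- by move=> i ni; apply: It; exact: leqW.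
- by move=> i ni; apply: tS; exact: leqW.
have mX i : measurable (X (t i) @^-1` [set j i]) by exact: measurable_preimage_nat.
have mE := measurable_path_event t j.
have [Qpath0|Qpath0] := eqVneq (Q (path_event X t j n.+1)) 0.
  rewrite Qpath0 mul0r; apply: (fap_null hQ _ _ _ Qpath0) => //.
  by rewrite path_eventS => x [].
have Qpath : 0 < Q (path_event X t j n.+1).
  by rewrite lt_neqAle eq_sym Qpath0 (fap_ge0 hQ).
have QX : 0 < Q (X (t n) @^-1` [set j n]).
  by apply: lt_le_trans Qpath _; apply: (fap_le hQ) => //; exact: path_event_sub.
have jnK : (j n <= K)%N.
  by rewrite leqNgt; apply/negP => /(chain_out (hK _ (It n _))) QX0;
    move: QX; rewrite QX0// ltxx.
have [jK|Kj] := leqP (j n.+1) K; last first.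
  rewrite tr0 ?mulr0; last by rewrite negb_and -!ltnNge Kj orbT.
  apply: (fap_null hQ _ _ (path_event_sub (n := _))) => //.
  by apply: chain_out Kj; apply: hK; exact: It.
rewrite -(htr _ _ _ _ _ _ _ jnK jK QX); [|exact: It|exact: It|exact: tS].
by rewrite -hM// path_eventS /cond mulrC divfK.
Qed.

(** The point (s0, m0) only fixes the law at the first observation time; the
    ratio of the weights of two paths that differ by their last step is a
    single transition probability, whatever happened before. *)
Lemma path_markov s0 m0 :
  (forall s, I s -> Q [set w | (X s w <= K)%N] = 1) ->
  (forall n t j, (forall i, (i <= n)%N -> I (t i)) ->
    (forall i, (i < n)%N -> t i < t i.+1) ->
    Q (path_event X t j n.+1) = chain_weight tr s0 m0 t j n) ->
  markov_chain Q X I K tr.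
Proof.
move=> hK hpath.
have htr (s s' : R) (m k : nat) : I s -> I s' -> s < s' ->
    0 < Q (X s @^-1` [set m]) ->
    cond Q (X s @^-1` [set m]) (X s' @^-1` [set k]) = tr s s' m k.
  move=> Is Is' ss'; pose t' i := if i is 0%N then s else s'.
  pose j' i := if i is 0%N then m else k.
  have It' i : I (t' i) by case: i.
  have p1 : Q (X s @^-1` [set m]) = chain_weight tr s0 m0 t' j' 0.
    by rewrite -(path_event1 t' j') hpath.
  have p2 : Q (X s' @^-1` [set k] `&` X s @^-1` [set m])
      = chain_weight tr s0 m0 t' j' 1.
    by rewrite -hpath ?path_eventS ?path_event0 ?setIT// => -[].
  by rewrite /cond p2 p1 chain_weightS => w0; rewrite mulrC mulKf// gt_eqF.
split => // [n t j It tS Qpath|s s' m k Is Is' ss' _ _]; last exact: htr.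
rewrite htr; last first.
- apply: lt_le_trans Qpath _; apply: (fap_le hQ).
  + exact: measurable_path_event.
  + exact: measurable_preimage_nat.
  + exact: path_event_sub.
- exact: tS.
- exact: It.
- exact: It.
rewrite /cond -path_eventS hpath// chain_weightS -hpath//; last 2 first.
- by move=> i ni; apply: It; exact: leqW.
- by move=> i ni; apply: tS; exact: ltnW.
by rewrite mulrC mulKf// gt_eqF.
Qed.

End Paths.

Section Laws.
Context d (T : measurableType d) (R : realType) (X : R -> {mfun T >-> nat}).
Variable Q : set T -> R.
Hypothesis hQ : finitely_additive_probability Q.
Variables (A B : R) (n : nat) (t : nat -> R) (j : nat -> nat).
Hypotheses (ht : forall i, (i <= n)%N -> - A - B < t i)
  (tS : forall i, (i < n)%N -> t i < t i.+1).

(** Observing in addition the deterministic state 0 at time - A - B does not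
    change the probability of the path. *)
Lemma xiK_path K : is_xiK K A B Q X ->
  Q (path_event X t j n.+1) = chain_weight (xiK_trans K A) (- A - B) 0 t j n.
Proof.
move=> [hX X0]; pose t' i := if i is i'.+1 then t i' else - A - B.
pose j' i := if i is i'.+1 then j i' else 0%N.
have := @markov_path _ _ _ X Q hQ _ _ _ hX (@xiK_trans_eq0 _ _ _) n.+1 t' j'.
rewrite path_event_cons setIC (fap_setIr hQ _ _ X0); last 2 first.
- exact: measurable_path_event.
- exact: measurable_preimage_nat.
rewrite X0 mul1r big_ord_recl => -> //.
- by case=> [|i] /= ni; [exact: lexx|apply/ltW/ht].
- by case=> [|i] ni /=; [exact: ht|exact: tS].
Qed.

(** There is no state at time - A - B here, but the law p of the first observed
    state is the expression of [xi_trans] at that time and state 0. *)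
Lemma xi_path N C : is_xi N A B C Q X ->
  Q (path_event X t j n.+1) = chain_weight (xi_trans N A C) (- A - B) 0 t j n.
Proof.
move=> [hX X0].
rewrite (markov_path hQ hX (@xi_trans_eq0 _ _ _ _))//; congr (_ * _).
have [jN|Nj] := leqP (j 0%N) N; last first.
  rewrite (chain_out hQ _ Nj); last by apply: (chain_range hX); exact: ht.
  by rewrite xi_trans_eq0// -ltnNge.
rewrite X0//; last exact: ht.
by rewrite /xi_trans jN !subn0 addr0 subr0; congr p_weight; ring.
Qed.

End Laws.

(** * Mixing over Theta *)

Lemma total_probability d (T : measurableType d) (R : realType)
    (Q : set T -> R) (Y : {mfun T >-> nat}) N :
  finitely_additive_probability Q ->
  \sum_(0 <= k < N) Q (Y @^-1` [set k]) = 1 ->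
  forall E, measurable E ->
  Q E = \sum_(0 <= k < N) Q (E `&` Y @^-1` [set k]).
Proof.
move=> hQ Q1.
have mY D : measurable (Y @^-1` D) by exact: measurable_preimage_nat.
(* The atoms are collected one by one, so that finite additivity suffices. *)
have below n E : measurable E -> Q (E `&` Y @^-1` [set k | (k < n)%N])
    = \sum_(0 <= k < n) Q (E `&` Y @^-1` [set k]).
  move=> mE; elim: n => [|n IHn].
    rewrite big_geq// (_ : _ `&` _ = set0); last by apply/seteqP; split => x // [].
    have /eqP := fap_setU hQ measurable0 measurable0 (setI0 set0).
    by rewrite setU0 -subr_eq0 opprD addNKr oppr_eq0 => /eqP.
  rewrite big_nat_recr//= -IHn -(fap_setU hQ).
  - congr Q; rewrite -setIUr -preimage_setU; congr (_ `&` _ @^-1` _).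
    apply/seteqP; split => k /=.
      by rewrite ltnS leq_eqVlt => /predU1P[->|kn]; [right|left].
    by case=> [kn|->]; [exact: leqW|exact: ltnSn].
  - exact: measurableI.
  - exact: measurableI.
  - by apply/seteqP; split => x //= [[_ Yn] [_ Yx]]; move: Yn; rewrite Yx ltnn.
move=> E mE; rewrite -below// (fap_setIr hQ)//.
rewrite -[LHS](congr1 Q (setTI _)) below//.
by under eq_bigr => k _ do rewrite setTI.
Qed.

Theorem proposition3p5 (R : realType) (N : nat) (A B C : R)
  (hN : (1 <= N)%N) (hA : - (1 / 2) < A) (hB : - A < B < A + 1)
  (hC : C < - A - N%:R + 1)
  (d : measure_display) (Omega : measurableType d) (P : probability Omega R)
  (Theta : {mfun Omega >-> nat}) (xiTheta : R -> {mfun Omega >-> nat})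
  (Theta_law : forall k : nat,
     prob P (Theta @^-1` [set k]) = theta_law N A B C k)
  (xiTheta_cond : forall K : nat, (K <= N)%N ->
     is_xiK K A B (cond (prob P) (Theta @^-1` [set K])) xiTheta) :
  (* the process xi^(Theta) is, unconditionally, the Markov chain xi *)
  is_xi N A B C (prob P) xiTheta
  /\
  (* joint laws, for any Markov chain xi on any probability space *)
  (forall (d' : measure_display) (Omega' : measurableType d')
     (P' : probability Omega' R) (xi : R -> {mfun Omega' >-> nat}),
   is_xi N A B C (prob P') xi ->
   forall (n : nat) (t : nat -> R) (j : nat -> nat),
   (forall i, (i <= n)%N -> - A - B < t i) ->
   (forall i, (i < n)%N -> t i < t i.+1) ->
   prob P (path_event xiTheta t j n.+1) = prob P' (path_event xi t j n.+1)
   /\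
   (* the mixture formula, for any Markov chains xi^(k), k = 0, ..., N *)
   (forall (dk : nat -> measure_display)
      (Omegak : forall k : nat, measurableType (dk k))
      (Pk : forall k : nat, probability (Omegak k) R)
      (xik : forall k : nat, R -> {mfun Omegak k >-> nat}),
    (forall k, (k <= N)%N -> is_xiK k A B (prob (Pk k)) (xik k)) ->
    (forall i, (i < n)%N -> (j i <= j i.+1)%N) ->
    (j n <= N)%N ->
    \sum_(j n <= k < N.+1)
      prob P (Theta @^-1` [set k]) * prob (Pk k) (path_event (xik k) t j n.+1)
    = prob P' (path_event xi t j n.+1))).
Proof.
have fP := fap_prob P.
have mTheta k : measurable (Theta @^-1` [set k]) by exact: measurable_preimage_nat.
have Theta_neq0 K : (K <= N)%N -> prob P (Theta @^-1` [set K]) != 0.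
  (* With the convention x / 0 = 0, a null conditioning event would give
     the start at 0 the conditional probability 0 rather than 1. *)
  move=> /xiTheta_cond[_]; rewrite /cond; case: eqP => // -> /eqP.
  by rewrite invr0 mulr0 eq_sym oner_eq0.
have fPK K : (K <= N)%N ->
    finitely_additive_probability (cond (prob P) (Theta @^-1` [set K])).
  by move=> KN; apply: fap_cond => //; exact: Theta_neq0.
have total E : measurable E -> prob P E = \sum_(0 <= K < N.+1)
    theta_law N A B C K * cond (prob P) (Theta @^-1` [set K]) E.
  move=> mE; rewrite (total_probability (Y := Theta) (N := N.+1) fP)//.
    apply: eq_big_nat => K /andP[_ KN]; rewrite -Theta_law /cond mulrC divfK//.
    exact: Theta_neq0.
  under eq_bigr => K _ do rewrite Theta_law.
  by apply: sum_theta_law => //; case/andP: hB.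
have path n t j : (forall i, (i <= n)%N -> - A - B < t i) ->
    (forall i, (i < n)%N -> t i < t i.+1) ->
    prob P (path_event xiTheta t j n.+1)
    = chain_weight (xi_trans N A C) (- A - B) 0 t j n.
  move=> ht tS; rewrite total; last exact: measurable_path_event.
  rewrite -(sum_path hB hC j ht tS); apply: eq_big_nat => K /andP[_ KN].
  congr (_ * _); exact: (xiK_path (fPK K KN) j ht tS (xiTheta_cond K KN)).
split=> [|d' Omega' P' xi hxi n t j ht tS].
  split.
    apply: (path_markov fP (s0 := - A - B) (m0 := 0%N) _ path) => t It.
    pose E D := xiTheta t @^-1` [set k | (k <= D)%N].
    have mE D : measurable (E D) by exact: measurable_preimage_nat.
    rewrite (total (E N))// -[RHS](@sum_theta_law _ N A B C)//; last by case/andP: hB.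
    apply: eq_big_nat => K /andP[_ KN]; rewrite -[RHS]mulr1; congr (_ * _).
    apply/eqP; rewrite eq_le; apply/andP; split.
      rewrite -(fap_setT (fPK K KN)); exact: (fap_le (fPK K KN)).
    rewrite -(chain_range (xiK_chain (xiTheta_cond K KN)) (ltW It)).
    apply: (fap_le (fPK K KN)) => //; first exact: (mE K).
    by move=> x /= /leq_trans; apply.
  move=> t j It jN; have := @path 0%N (fun=> t) (fun=> j).
  rewrite path_event1 => ->//.
  rewrite /chain_weight big_ord0 mulr1 /xi_trans jN !subn0 addr0 subr0.
  by congr p_weight; ring.
have xiE := xi_path (fap_prob P') j ht tS hxi.
split; first by rewrite path// xiE.
move=> dk Omegak Pk xik hxik jS jN.
rewrite xiE -(sum_path_ge hB hC ht tS jN); apply: eq_big_nat => K /andP[_ KN].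
by rewrite Theta_law (xiK_path (fap_prob (Pk K)) j ht tS (hxik K KN)).
Qed.
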